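(* Let $q$ be a prime power and let $M(x)\in\mathbb{F}_q[x]$ be a monic self-reciprocal polynomial of degree $2m$ with $M(0)=1$ of the form $M(x)=(x-1)^2g_1(x)\cdots g_{r-1}(x)$, where the $g_i$ are pairwise different monic irreducible polynomials, none equal to $x\pm1$. Let $M_t(x)=M(x)+tx^m\in\mathbb{F}_q(t)[x]$ and let $H$ be its Galois group over $\mathbb{F}_q(t)$. Then $H$ contains all transpositions on the roots of $M_t$ (i.e., for each root $\alpha$, the permutation interchanging $\alpha$ and $\alpha^{-1}$ and fixing all other roots), and hence $H$ contains a normal elementary abelian $2$-subgroup $N$ of order $2^m$.
   Context: A monic polynomial $g$ of degree $d$ with $g(0)\ne0$ is self-reciprocal if $g(x)=x^dg(0)^{-1}g(x^{-1})$. $M_t$ is irreducible and self-reciprocal, so its roots come in $m$ pairs $\{\alpha_i,\alpha_i^{-1}\}$; $N$ is the kernel of the action of $H$ on these $m$ pairs. *)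

(* Defs.v *)
From HB Require Import structures.
From mathcomp Require Import all_boot all_order all_algebra all_fingroup all_solvable all_field.
Set Implicit Arguments. Unset Strict Implicit. Unset Printing Implicit Defensive.
Import GRing.Theory.
Local Open Scope ring_scope.

Definition recip_poly (R : nzRingType) (g : {poly R}) : {poly R} :=
  \poly_(i < size g) g`_(size g - 1 - i).

Definition self_reciprocal (F : fieldType) (g : {poly F}) : Prop :=
  g.[0] != 0 /\ g = (g.[0])^-1 *: recip_poly g.

Definition ratfun (F : fieldType) := {fraction {poly F}}.
Definition tvar (F : fieldType) : {fraction {poly F}} := tofrac 'X.
Definition constF (F : fieldType) (c : F) : {fraction {poly F}} := tofrac c%:P.

Definition Mt (F : fieldType) (M : {poly F}) (m : nat) : {poly {fraction {poly F}}} :=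
  map_poly (@constF F) M + tvar F *: 'X^m.

(* Main.v *)
Require Import Defs.
From mathcomp Require Import boolp classical_sets ring zify.
From HB Require Import structures.
From mathcomp Require Import all_boot all_order all_algebra all_fingroup all_solvable all_field.
Import GRing.Theory.
Local Open Scope ring_scope.

Set Implicit Arguments.
Unset Strict Implicit.
Unset Printing Implicit Defensive.

(** Let [B] be the integral closure of [F[t]] in [L] and [P] a prime of [B]
    containing [t].  Modulo [P] the pencil becomes [(x - 1)^2 G(x)] with [G]
    separable and [G(1) <> 0], so exactly one pair [a, 1/a] of roots reduces to
    [1] and all other roots stay distinct.  As [t = (a - 1)^2 w] with [w] in [B],
    [P] is ramified over [t]; hence some [s <> 1] in the Galois group acts
    trivially on [B / P].  Such an [s] must swap [a] and [1/a] and fix the other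
    roots.  The pencil has degree 1 in [t], so it is irreducible and conjugation
    moves this transposition to every pair.  The kernel of the action on the [m]
    pairs is then the full group of sign changes. *)

(** * Fractions and the integral closedness of [F[t]] *)

Lemma fraction_divP (R : idomainType) (x : {fraction R}) :
  exists a b : R, b != 0 /\ x = tofrac a / tofrac b.
Proof.
elim/quotW: x => r; exists \n_r, \d_r; split; first exact: denom_ratioP.
have nz : \d_r != 0 by exact: denom_ratioP.
apply: (canRL (mulfK _)); first by rewrite tofrac_eq0.
unlock tofrac; rewrite -[LHS]FracField.pi_mul.
apply/eqP; rewrite piE FracField.equivfE /FracField.mulf /=.
rewrite !numden_Ratio ?oner_neq0 ?mulf_neq0 ?oner_neq0 //.
by rewrite !mulr1 mulrC.
Qed.

Lemma exprn_div_clear (K : fieldType) (a b : K) i n :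
  b != 0 -> (i <= n)%N -> b ^+ n * (a / b) ^+ i = a ^+ i * b ^+ (n - i).
Proof.
move=> nzb lein; rewrite expr_div_n -{1}(subnK lein) exprD.
by field; rewrite expf_neq0.
Qed.

(* If [a / b] is a root of a monic polynomial, clearing denominators shows that
   [b] divides a power of [a]. *)
Lemma integral_fraction_poly (F : fieldType) (x : {fraction {poly F}}) :
  integralOver (@tofrac {poly F}) x -> exists f, x = tofrac f.
Proof.
have [a [b [nzb ->]]] := fraction_divP x; case=> q monq.
pose d := gcdp a b.
have nzd : d != 0 by rewrite gcdp_eq0 (negPf nzb) andbF.
have [da db] := (dvdp_gcdl a b, dvdp_gcdr a b).
pose a1 := a %/ d; pose b1 := b %/ d.
have ea : a = a1 * d by rewrite divpK.
have eb : b = b1 * d by rewrite divpK.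
have nzb1 : b1 != 0 by apply: contraNneq nzb => b10; rewrite eb b10 mul0r.
have cop : coprimep a1 b1 by rewrite coprimep_div_gcd // nzb orbT.
have -> : tofrac a / tofrac b = tofrac a1 / tofrac b1.
  rewrite ea eb !rmorphM /= invfM mulrACA divff ?mulr1 //.
  by rewrite tofrac_eq0.
have nzFb : tofrac b1 != 0 :> {fraction {poly F}} by rewrite tofrac_eq0.
rewrite /root horner_coef size_map_inj_poly ?tofrac0 //; last first.
  by move=> u v /eqP; rewrite tofrac_eq => /eqP.
have [n sq] : exists n, size q = n.+1.
  by exists (size q).-1; rewrite prednK // size_poly_gt0 monic_neq0.
rewrite sq => /eqP root_q.
have : \sum_(i < n.+1) q`_i * a1 ^+ i * b1 ^+ (n - i) = 0.
  apply/eqP; rewrite -(@tofrac_eq0 {poly F}) rmorph_sum /=; apply/eqP.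
  rewrite -[RHS](mulr0 (tofrac b1 ^+ n)) -[in RHS]root_q mulr_sumr.
  apply: eq_bigr => -[i /= lti] _; rewrite coef_map_id0 ?tofrac0 //.
  by rewrite mulrCA exprn_div_clear // !rmorphM !rmorphXn /= mulrA.
rewrite big_ord_recr /= subnn mulr1 => /eqP.
have -> : q`_n = 1 by rewrite -(monicP monq) /lead_coef sq.
rewrite mul1r addrC addr_eq0 => /eqP e.
have dvd : b1 %| a1 ^+ n.
  rewrite e dvdpNr; apply: (big_ind (fun r => b1 %| r)) => [|u v|i _].
  - by rewrite dvdp0.
  - exact: dvdp_add.
  - by rewrite dvdp_mull // -(subnSK (ltn_ord i)) exprS dvdp_mulr.
(* Coprimality of [a1] and [b1] turns the divisibility into [b1] being a unit, that is, a nonzero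
   constant. *)
have : b1 %| 1.
  by move: dvd; rewrite -[a1 ^+ n]mulr1 Gauss_dvdpr // coprimep_sym coprimep_expl.
rewrite dvdp1 => /size_poly1P[c nzc eb1].
exists (c^-1 *: a1); rewrite -mul_polyC rmorphM /= mulrC; congr (_ * _).
move: nzFb; rewrite eb1 => nz; apply: (mulfI nz).
by rewrite divff // -rmorphM -polyCM divff.
Qed.

(** * Primes of a subring above a non-unit *)

(** Both [B] and [P] are predicates on the ambient ring [L]; closure of [P] under subtraction is
    carried by its [zmodClosed] structure. *)
Definition prime_ideal_of (L : comNzRingType) (B P : {pred L}) :=
  [/\ {subset P <= B}, {in B & P, forall b x, b * x \in P}, 1 \notin P &
      {in B &, forall x y, x * y \in P -> (x \in P) || (y \in P)}].

Section PrimeIdeal.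

Variables (L : comNzRingType) (B : subringClosed L) (t : L).
Hypotheses (Bt : t \in B) (tNunit : {in B, forall c, t * c != 1}).

Local Open Scope classical_set_scope.

(* The empty set is admitted so that the union of the empty chain qualifies. *)
Let proper (I : set L) :=
  [/\ forall x, I x -> x \in B /\ I t,
      forall x y, I x -> I y -> I (x - y),
      forall b x, b \in B -> I x -> I (b * x) & ~ I 1].

(** Zorn's lemma gives an ideal of [B] maximal among the proper ones that contain [t], and such an
    ideal is prime. *)
Lemma exists_prime_ideal :
  exists P : zmodClosed L, prime_ideal_of B P /\ t \in P.
Proof.
have [|I [[IB ID IM I1] Imax]] := @Zorn_bigcup L proper.
  move=> C Cproper Ctot; split.
  - move=> x [X CX Xx]; have [XB _ _ _] := Cproper _ CX.
    by have [Bx Xt] := XB x Xx; split=> //; exists X.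
  - move=> x y [X CX Xx] [Y CY Yy].
    have [_ XD _ _] := Cproper _ CX; have [_ YD _ _] := Cproper _ CY.
    have [XY|YX] := Ctot _ _ CX CY.
      by exists Y => //; apply: YD => //; apply: XY.
    by exists X => //; apply: XD => //; apply: YX.
  - move=> b x Bb [X CX Xx]; have [_ _ XM _] := Cproper _ CX.
    by exists X => //; apply: XM.
  - by case=> X CX X1; have [_ _ _ ] := Cproper _ CX.
have maxI (I' : set L) x : I `<=` I' -> proper I' -> I' x -> I x.
  move=> sII' pI' I'x; apply: contrapT => Ix.
  by apply: (Imax I') => //; split=> // /(_ x I'x).
(* Without [t] the maximal element would be empty, hence contained in [t * B]; that ideal is proper
   since [t] has no inverse in [B], so maximality puts [t] in [I] after all. *)
have It : I t.
  apply: contrapT => NIt; apply: (NIt).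
  apply: (maxI [set t * b | b in [set b | b \in B]]).
  - by move=> x /IB[].
  - split.
    + move=> _ [b /= Bb <-]; split; rewrite ?rpredM //.
      by exists 1; rewrite ?mulr1 //= rpred1.
    + by move=> _ _ [b /= Bb <-] [c /= Bc <-]; exists (b - c); rewrite ?mulrBr //= rpredB.
    + by move=> b _ Bb [c /= Bc <-]; exists (b * c); rewrite 1?mulrCA //= rpredM.
    + by case=> b /= Bb /eqP; apply/negP/tNunit.
  - by exists 1; rewrite ?mulr1 //= rpred1.
have I0 : I 0 by rewrite -(subrr t); apply: ID.
have IN x : I x -> I (- x) by rewrite -sub0r; apply: ID.
have IA x y : I x -> I y -> I (x + y).
  by move=> Ix Iy; rewrite -[y]opprK; apply: ID => //; apply: IN.
pose P : {pred L} := fun x => `[< I x >].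
have PE x : reflect (I x) (x \in P) by exact: asboolP.
have zP : zmod_closed P.
  by split=> [|x y /PE Ix /PE Iy]; apply/PE; [|exact: ID].
pose Pz := GRing.isZmodClosed.Build L P zP.
exists (HB.pack_for (zmodClosed L) P Pz); split; last exact/PE.
split=> [x /PE/IB[] //|b x Bb /PE Ix||x y Bx By /PE Ixy].
- by apply/PE/IM.
- by apply/PE.
apply: contraT; rewrite negb_or => /andP[/PE Ix /PE Iy].
(* For [z] outside [I] the ideal [B * z + I] is strictly larger, so maximality forces it to contain
   1. *)
have gen z : z \in B -> ~ I z -> exists b c, [/\ b \in B, I c & 1 = b * z + c].
  move=> Bz Iz; apply: contrapT => no; apply: Iz.
  apply: (maxI [set w | exists b c, [/\ b \in B, I c & w = b * z + c]]).
  - by move=> w Iw; exists 0, w; rewrite rpred0 mul0r add0r.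
  - split.
    + move=> _ [b [c [Bb Ic ->]]]; split; last by exists 0, t; rewrite rpred0 mul0r add0r.
      by rewrite rpredD ?rpredM //; case: (IB c Ic).
    + move=> _ _ [b [c [Bb Ic ->]]] [b' [c' [Bb' Ic' ->]]].
      exists (b - b'), (c - c'); split; [by rewrite rpredB | exact: ID|].
      by rewrite mulrBl opprD addrACA.
    + move=> a _ Ba [b [c [Bb Ic ->]]]; exists (a * b), (a * c).
      by split; [rewrite rpredM | exact: IM | rewrite mulrDr mulrA].
    + by [].
  - by exists 1, 0; rewrite rpred1 mul1r addr0.
have [b [c [Bb Ic e1]]] := gen x Bx Ix; have [b' [c' [Bb' Ic' e2]]] := gen y By Iy.
(* Multiplying the two expressions of 1 leaves one term in [x * y], which is in [I] by assumption,
   and terms with a factor [c] or [c']. *)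
case: I1; have -> : 1 = (b * b') * (x * y) + ((b * x) * c' + (b' * y) * c + c * c').
  by rewrite -[LHS]mulr1 {1}e1 e2; ring.
have Bc' : c' \in B by case: (IB c' Ic').
have Bc : c \in B by case: (IB c Ic).
by apply: (IA _ _ _ (IA _ _ (IA _ _ _ _) _)); apply: (IM); rewrite ?rpredM.
Qed.

End PrimeIdeal.

(** * Separability over finite fields; palindromic polynomials *)

(** Extensions of finite fields are Galois, so a root of [g] in a splitting field has a separable
    minimal polynomial, and irreducibility makes it an associate of [g]. *)
Lemma irreducible_separable_finField (F : finFieldType) (g : {poly F}) :
  irreducible_poly g -> separable_poly g.
Proof.
move=> irr; have nzg : g != 0 by rewrite -size_poly_gt0 ltnW //; case: irr.
have [L [rs grs _]] := FinSplittingFieldFor nzg.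
case: rs grs => [|x rs] grs.
  have /eqP : size (map_poly (in_alg L) g) == 1%N.
    by rewrite size_poly_eq1 (eqp_trans grs) // big_nil eqpxx.
  by rewrite size_map_poly => e; case: irr; rewrite e.
have gx : root (map_poly (in_alg L) g) x.
  by rewrite (eqp_root grs) root_prod_XsubC mem_head.
have /and3P[_ /separableP sep _] : galois 1 {:L} by apply/finField_galois/sub1v.
have {sep} := sep x (memvf x); rewrite /separable_element.
have /polyOver1P[q eq] := minPolyOver 1 x.
rewrite eq separable_map => sepq.
have qx : root (map_poly (in_alg L) q) x by rewrite -eq root_minPoly.
have dvd : q %| g.
  rewrite -(dvdp_map (in_alg L)) -eq minPoly_dvdp //.
  by apply/polyOver1P; exists g.
suff : q %= g by move/eqp_separable <-.
case: irr => _; apply=> //; rewrite -(size_map_poly (in_alg L)).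
by rewrite -eq size_minPoly.
Qed.

(** These are the Dickson polynomials, from the recursion [h_(k+2) = 'X * h_(k+1) - h_k]. One [h]
    serves every extension [f], so identities can be used both over [F] and over the splitting
    field. *)
Lemma exists_dickson_poly (F : fieldType) (k : nat) :
  exists h : {poly F}, forall (L : fieldType) (f : {rmorphism F -> L}) (x : L),
    x != 0 -> (map_poly f h).[x + x^-1] = x ^+ k + x ^- k.
Proof.
elim/ltn_ind: k => -[|[|k]] IH.
- exists (1 + 1) => L f x nzx.
  by rewrite rmorphD rmorph1 !hornerE expr0 invr1.
- by exists 'X => L f x nzx; rewrite map_polyX hornerX.
have [h1 e1] := IH k.+1 (ltnSn _); have [h0 e0] := IH k (leqnSn _).
exists ('X * h1 - h0) => L f x nzx.
rewrite rmorphB rmorphM /= map_polyX !hornerE e1 // e0 // -!exprVn.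
rewrite !exprS; field; exact: nzx.
Qed.

Lemma palindromic_poly (F : fieldType) (k : nat) (M : {poly F}) :
  (size M <= (2 * k).+1)%N ->
  (forall i, (i <= 2 * k)%N -> M`_i = M`_(2 * k - i)) ->
  exists h : {poly F}, forall (L : fieldType) (f : {rmorphism F -> L}) (x : L),
    x != 0 -> (map_poly f M).[x] = x ^+ k * (map_poly f h).[x + x^-1].
Proof.
elim: k M => [|k IH] M szM palM.
  exists M => L f x nzx; rewrite (size1_polyC szM) map_polyC !hornerC.
  by rewrite expr0 mul1r.
(* Stripping the two equal outer coefficients and dividing by ['X] leaves a palindromic polynomial
   of degree at most [2 * k]. *)
pose M1 := \poly_(i < (2 * k).+1) M`_i.+1.
have [|i lei|h1 e1] := IH M1; first exact: size_poly.
  rewrite !coef_poly !ifT; try lia.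
  rewrite palM; last lia.
  by congr (M`_ _); lia.
have [h2 e2] := exists_dickson_poly F k.+1.
exists (M`_0 *: h2 + h1) => L f x nzx.
have eM : M = (M`_0)%:P + M`_0 *: 'X^(2 * k.+1) + 'X * M1.
  apply/polyP => i; rewrite !coefD coefZ coefXn coefC coefXM coef_poly.
  case: i => [|i] /=; first by rewrite mulr0 !addr0.
  rewrite add0r; case: eqVneq => [e|ne]; rewrite ?mulr1 ?mulr0 ?add0r.
    rewrite ifF ?addr0; last by lia.
    by rewrite palM; [congr (M`_ _)|]; lia.
  case: ltnP => // le; apply/nth_default/(leq_trans szM); lia.
rewrite {1}eM !(rmorphD, rmorphM) /= !map_polyZ map_polyC map_polyXn map_polyX.
rewrite !hornerE e1 // e2 // mul2n -addnn exprD.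
rewrite !exprS; field; by rewrite nzx expf_neq0.
Qed.

(** * The integral closure of [F[t]] and a prime above [t] *)

Lemma gal_invr (K : fieldType) (L : splittingFieldType K) (s : gal_of {:L}) x :
  s x^-1 = (s x)^-1.
Proof. exact: fmorphV. Qed.

Section IntegralClosure.

Variables (F : fieldType) (L : fieldExtType {fraction {poly F}}).

Definition poly_to_ext : {poly F} -> L := in_alg L \o @tofrac {poly F}.
HB.instance Definition _ :=
  GRing.RMorphism.copy poly_to_ext (in_alg L \o @tofrac {poly F}).

Definition int_closure : {pred L} := fun x => `[< integralOver poly_to_ext x >].

Lemma int_closureP x : reflect (integralOver poly_to_ext x) (x \in int_closure).
Proof. exact: asboolP. Qed.

Fact int_closure_subring : subring_closed int_closure.
Proof.
split=> [|x y /int_closureP ix /int_closureP iy|x y /int_closureP ix /int_closureP iy];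
  apply/int_closureP; [exact: integral1|exact: integral_sub|exact: integral_mul].
Qed.
HB.instance Definition _ :=
  GRing.isSubringClosed.Build L int_closure int_closure_subring.

Lemma poly_to_ext_inj : injective poly_to_ext.
Proof.
by move=> f g /fmorph_inj/eqP; rewrite tofrac_eq => /eqP.
Qed.

Lemma poly_to_ext_int f : poly_to_ext f \in int_closure.
Proof. exact/int_closureP/integral_id. Qed.

Lemma poly_to_ext_mem1 f : poly_to_ext f \in 1%VS.
Proof. exact: rpredZ (mem1v _). Qed.

(** Integral closedness of [F[t]], transported along [in_alg L]. *)
Lemma int_closure_base x :
  x \in int_closure -> x \in 1%VS -> exists f, x = poly_to_ext f.
Proof.
move=> /int_closureP[q monq rq] /vlineP[k ek].
have [f ef] : exists f, k = tofrac f.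
  apply: integral_fraction_poly; exists q => //.
  by move: rq; rewrite ek map_poly_comp fmorph_root.
by exists f; rewrite ek ef.
Qed.

(** An inverse of the variable lies in the base field; if it were also integral it would be a
    polynomial, which evaluation at 0 refutes. *)
Lemma poly_to_extX_nunit : {in int_closure, forall c, poly_to_ext 'X * c != 1}.
Proof.
move=> c ic; apply/negP => /eqP e.
have nzX : poly_to_ext 'X != 0.
  by rewrite -(rmorph0 poly_to_ext) (inj_eq poly_to_ext_inj) polyX_eq0.
have [f ef] : exists f, c = poly_to_ext f.
  apply: int_closure_base => //.
  by rewrite -[c](mulKf nzX) e mulr1 rpredV poly_to_ext_mem1.
move: e; rewrite ef -rmorphM -(rmorph1 poly_to_ext) => /poly_to_ext_inj.
by move/(congr1 (horner^~ 0))/eqP; rewrite !hornerE ?mul0r eq_sym oner_eq0.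
Qed.

End IntegralClosure.

Arguments poly_to_ext {F} L.
Arguments int_closure {F} L.

(** * Galois action modulo a prime above the variable *)

Section PrimeOverX.

Variables (F : fieldType) (L : splittingFieldType {fraction {poly F}}).
Variable P : zmodClosed L.

Local Notation iota := (poly_to_ext L).
Local Notation B := (int_closure L).

Hypotheses (primeP : prime_ideal_of B P) (PX : iota 'X \in P).

Lemma gal_const (s : gal_of {:L}) f : s (iota f) = iota f.
Proof. exact: rmorph_alg. Qed.

Lemma gal_mem (s : gal_of {:L}) : s \in 'Gal({:L} / 1)%g.
Proof.
rewrite gal_kHom ?sub1v //; apply/kAHomP => u /vlineP[k ->].
exact: rmorph_alg.
Qed.

Lemma gal_int (s : gal_of {:L}) x : x \in B -> s x \in B.
Proof.
move=> /int_closureP[q monq rq]; apply/int_closureP; exists q => //.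
have -> : map_poly iota q = map_poly s (map_poly iota q).
  by rewrite -map_poly_comp; apply: eq_map_poly => f; rewrite /= gal_const.
by rewrite fmorph_root.
Qed.

Lemma prime_mull b x : b \in B -> x \in P -> b * x \in P.
Proof. by case: primeP => _ + _ _; apply. Qed.

Lemma prime_mulr b x : b \in B -> x \in P -> x * b \in P.
Proof. by move=> Bb Px; rewrite mulrC prime_mull. Qed.

Lemma prime_mulI x y : x \in B -> y \in B -> x * y \in P -> (x \in P) || (y \in P).
Proof. by case: primeP => _ _ _; apply. Qed.

Lemma prime_mulN x y :
  x \in B -> y \in B -> x \notin P -> y \notin P -> x * y \notin P.
Proof.
by move=> Bx By Px Py; apply/negP => /prime_mulI; rewrite (negPf Px) (negPf Py); auto.
Qed.

Lemma prime_const c : iota c%:P \in P -> c = 0.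
Proof.
have [//|nzc Pc] := eqVneq c 0; have : 1 \notin P by case: primeP.
have -> : 1 = iota c^-1%:P * iota c%:P by rewrite -rmorphM -polyCM mulVf // rmorph1.
by rewrite prime_mull // poly_to_ext_int.
Qed.

(** [P] meets [F[t]] exactly in the multiples of the variable: modulo ['X] only the constant term
    remains, and nonzero constants are units. *)
Lemma prime_poly f : iota f \in P -> exists g, f = 'X * g.
Proof.
move=> Pf; have /factor_theorem[g eg] : root (f - f.[0]%:P) 0.
  by rewrite /root !hornerE subrr.
rewrite subr0 mulrC in eg.
have f0 : f.[0] = 0.
  apply: prime_const.
  have -> : f.[0]%:P = f - 'X * g by rewrite -eg opprB addrC subrK.
  by rewrite rmorphB rmorphM rpredB //= prime_mulr ?poly_to_ext_int.
by exists g; rewrite -eg f0 subr0.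
Qed.

(** The list [r] encodes a tensor [sum u_j (x) v_j], built as a product over [s] in [S] of factors
    [x (x) 1 - 1 (x) y] with [s y = x] and [x - y] outside [P]. *)
Lemma prime_separating_tensor (S : seq (gal_of {:L})) :
    (forall s : gal_of {:L}, s != 1%g -> exists2 x, x \in B & s x - x \notin P) ->
    (forall s, s \in S -> s != 1%g) ->
  exists r : seq (L * L),
    [/\ forall w, w \in r -> (w.1 \in B) && (w.2 \in B),
        forall s, s \in S -> \sum_(w <- r) w.1 * s w.2 = 0 &
        \sum_(w <- r) w.1 * w.2 \notin P].
Proof.
move=> sepP; elim: S => [|s S IH] S1.
  exists [:: (1, 1)]; split=> [w|//|].
    by rewrite inE => /eqP -> /=; rewrite rpred1.
  by rewrite big_seq1 mulr1; case: primeP.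
have [s' s'S|r [rB rS rP]] := IH; first by rewrite S1 // inE s'S orbT.
have [|x Bx Px] := sepP s^-1%g; first by rewrite eq_invg1 S1 ?mem_head.
set y := s^-1%g x in Px; have By : y \in B by exact: gal_int.
have sy : s y = x by rewrite /y -galM ?memvf // mulVg gal_id.
exists ([seq (x * w.1, w.2) | w <- r] ++ [seq (w.1, - y * w.2) | w <- r]).
(* The new list is the old tensor times [x (x) 1 - 1 (x) y]. The factor [x - f y] vanishes for
   [f = s] and lies outside [P] for the identity. *)
have sumE (f : {rmorphism L -> L}) :
    \sum_(w <- [seq (x * w.1, w.2) | w <- r] ++ [seq (w.1, - y * w.2) | w <- r])
      w.1 * f w.2 = (x - f y) * \sum_(w <- r) w.1 * f w.2.
  rewrite big_cat !big_map /= mulrBl !mulr_sumr -sumrB; rewrite -big_split /=.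
  by apply: eq_bigr => w _; rewrite rmorphM rmorphN /=; ring.
split.
- move=> w; rewrite mem_cat => /orP[] /mapP[w' /rB /andP[B1 B2] ->] /=.
    by rewrite B2 rpredM.
  by rewrite B1 rpredM ?rpredN.
- move=> s'; rewrite sumE inE => /predU1P[->|/rS ->]; last by rewrite mulr0.
  by rewrite /= sy subrr mul0r.
- rewrite (sumE idfun); apply: prime_mulN => //; first by rewrite rpredB.
    by rewrite big_seq rpred_sum // => w /rB /andP[*]; rewrite rpredM.
  by rewrite -rpredN opprB.
Qed.

(* If no [s != 1] acted trivially modulo [P], a separating tensor [sum u_j (x) v_j]
   would give [d * b = sum u_j * Tr (v_j * b)] with [d] prime to [P], and these
   traces are polynomials in [P], hence multiples of the variable. *)
Lemma exists_inertia b :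
    galois 1 {:L} -> b \in B -> (forall s : gal_of {:L}, s b \in P) ->
    (forall d c, d \in B -> d \notin P -> c \in B -> d * b != iota 'X * c) ->
  exists2 s : gal_of {:L}, s != 1%g & forall x, x \in B -> s x - x \in P.
Proof.
move=> gal1 Bb Pb ram; apply: contrapT => none.
have sepP (s : gal_of {:L}) : s != 1%g -> exists2 x, x \in B & s x - x \notin P.
  move=> s1; apply: contrapT => noX; apply: none; exists s => // x Bx.
  by apply: contraT => Px; case: noX; exists x.
have [s|r [rB rS rP]] := prime_separating_tensor
  (S := [seq s <- enum {: gal_of {:L}} | s != 1%g]) sepP.
  by rewrite mem_filter => /andP[].
pose tr x := \sum_(s : gal_of {:L}) s x.
have dE : (\sum_(w <- r) w.1 * w.2) * b = \sum_(w <- r) w.1 * tr (w.2 * b).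
  (* In this sum over the whole group only [s = 1] survives; exchanging the two sums produces the
     traces. *)
  transitivity (\sum_(s : gal_of {:L}) s b * \sum_(w <- r) w.1 * s w.2).
    rewrite (bigD1 1%g) //= [X in _ + X]big1 ?addr0 => [|s s1].
      by rewrite gal_id mulrC; congr (_ * _); apply: eq_bigr => w _; rewrite gal_id.
    by rewrite rS ?mulr0 // mem_filter s1 mem_enum.
  under eq_bigr do rewrite mulr_sumr; rewrite exchange_big /=.
  apply: eq_bigr => w _; rewrite mulr_sumr; apply: eq_bigr => s _.
  by rewrite rmorphM /=; ring.
have trX x : x \in B -> exists2 c, c \in B & tr (x * b) = iota 'X * c.
  move=> Bx.
  have [f ef] : exists f, tr (x * b) = iota f.
    apply: int_closure_base.
      by rewrite rpred_sum // => s _; rewrite gal_int // rpredM.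
    have -> : tr (x * b) = galTrace 1 {:L} (x * b).
      by apply: eq_bigl => s; rewrite gal_mem.
    by apply: mem_galTrace; rewrite ?memvf.
  have [|g eg] := @prime_poly f.
    rewrite -ef rpred_sum // => s _; rewrite rmorphM.
    by apply: prime_mull (Pb s); apply: gal_int.
  by exists (iota g); rewrite ?poly_to_ext_int // ef eg rmorphM.
have [c Bc ec] : exists2 c, c \in B & \sum_(w <- r) w.1 * tr (w.2 * b) = iota 'X * c.
  elim: r rB {rS rP dE} => [|w r IH] rB.
    by exists 0; rewrite ?rpred0 // big_nil mulr0.
  have [w' w'r|c Bc ec] := IH; first by rewrite rB // inE w'r orbT.
  have /andP[B1 /trX[c' Bc' ec']] := rB w (mem_head _ _).
  exists (w.1 * c' + c); first by rewrite rpredD ?rpredM.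
  by rewrite big_cons ec ec'; ring.
have Bd : \sum_(w <- r) w.1 * w.2 \in B.
  by rewrite big_seq rpred_sum // => w /rB /andP[*]; rewrite rpredM.
by have := ram _ c Bd rP Bc; rewrite dE ec eqxx.
Qed.

End PrimeOverX.

(** * The pencil [M + t x^m] *)

Definition const_to_ext (F : fieldType) (L : fieldExtType {fraction {poly F}}) :
  F -> L := poly_to_ext L \o polyC.
HB.instance Definition _ (F : fieldType) (L : fieldExtType {fraction {poly F}}) :=
  GRing.RMorphism.copy (@const_to_ext F L) (poly_to_ext L \o polyC).
Arguments const_to_ext {F} L.

Section Pencil.

Variables (F : fieldType) (m : nat) (M G : {poly F}).
Variable (L : splittingFieldType {fraction {poly F}}).

Local Notation iota := (poly_to_ext L).
Local Notation cst := (const_to_ext L).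
Local Notation B := (int_closure L).
Local Notation t := (iota 'X).
Local Notation p := (map_poly (in_alg L) (Mt M m)).

Hypotheses (monM : M \is monic) (szM : size M = (2 * m).+1).
Hypothesis MG : M = ('X - 1) ^+ 2 * G.

(** The pencil over [F[t]]: the outer variable is [x], and [t] is the coefficient ['X%:P]. *)
Let MtXY : {poly {poly F}} := M^:P + 'X%:P * 'X^m.

Lemma pencil_lift : p = map_poly iota MtXY.
Proof.
rewrite [RHS](map_poly_comp (in_alg L) (@tofrac {poly F})).
congr (map_poly (in_alg L) _).
rewrite /Mt rmorphD rmorphM /= map_polyC map_polyXn -mul_polyC; congr (_ + _).
by rewrite -map_poly_comp.
Qed.

Lemma pencilE : p = map_poly cst M + t%:P * 'X^m.
Proof.
rewrite pencil_lift rmorphD rmorphM /= map_polyC map_polyXn; congr (_ + _).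
by rewrite -map_poly_comp.
Qed.

Lemma pencil_horner x : p.[x] = (map_poly cst M).[x] + t * x ^+ m.
Proof. by rewrite pencilE !hornerE. Qed.

Lemma pencil_size_gt0 : (0 < m)%N.
Proof.
have nzM := monic_neq0 monM; have := szM; rewrite MG.
have nzG : G != 0 by apply: contraNneq nzM; rewrite MG => ->; rewrite mulr0.
rewrite size_monicM ?monic_exp -?polyC1 ?monicXsubC //.
by rewrite size_exp_XsubC; have := size_poly_gt0 G; rewrite nzG; lia.
Qed.

Lemma pencil_lift_size : size MtXY = (2 * m).+1.
Proof.
have := pencil_size_gt0 => m0.
rewrite size_polyDl size_map_polyC szM // mul_polyC.
by rewrite (leq_ltn_trans (size_scale_leq _ _)) // size_polyXn; lia.
Qed.

Lemma pencil_lift_monic : MtXY \is monic.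
Proof.
rewrite monicE lead_coefDl ?lead_coef_map_inj //.
- by rewrite (monicP monM).
- exact: polyC_inj.
have := pencil_size_gt0 => m0.
rewrite size_map_polyC szM // mul_polyC.
by rewrite (leq_ltn_trans (size_scale_leq _ _)) // size_polyXn; lia.
Qed.

Lemma pencil_monic : p \is monic.
Proof. by rewrite pencil_lift monic_map ?pencil_lift_monic. Qed.

Lemma pencil_size : size p = (2 * m).+1.
Proof.
rewrite pencil_lift size_map_inj_poly ?rmorph0 ?pencil_lift_size //.
exact: poly_to_ext_inj.
Qed.

Hypotheses (M0 : M.[0] = 1) (G1 : G.[1] != 0) (sepG : separable_poly G).
Hypothesis palM : forall i, (i <= 2 * m)%N -> M`_i = M`_(2 * m - i).

Variable rs : seq L.
Hypothesis p_rs : p %= \prod_(x <- rs) ('X - x%:P).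
Hypothesis gen_rs : <<1 & rs>>%VS = fullv.

Lemma pencil_prod : p = \prod_(x <- rs) ('X - x%:P).
Proof. by apply/eqP; rewrite -eqp_monic ?pencil_monic ?monic_prod_XsubC. Qed.

Lemma pencil_root x : root p x = (x \in rs).
Proof. by rewrite pencil_prod root_prod_XsubC. Qed.

Lemma size_roots : size rs = (2 * m)%N.
Proof. by have := pencil_size; rewrite pencil_prod size_prod_XsubC => -[]. Qed.

Lemma roots_int x : x \in rs -> x \in B.
Proof.
rewrite -pencil_root pencil_lift => rx; apply/int_closureP.
by exists MtXY; rewrite ?pencil_lift_monic.
Qed.

Lemma roots_eq x : x \in rs -> (map_poly cst M).[x] = - (t * x ^+ m).
Proof.
by rewrite -pencil_root /root pencil_horner addr_eq0 => /eqP.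
Qed.

Lemma roots_neq0 x : x \in rs -> x != 0.
Proof.
move=> rx; apply: contraTneq isT => x0; move: (roots_eq rx).
rewrite x0 -(rmorph0 cst) horner_map M0 rmorph1 rmorph0 expr0n.
by have := pencil_size_gt0; case: (m) => //= k _ /eqP; rewrite mulr0 oppr0 oner_eq0.
Qed.

(** A monic relation over the constants is a polynomial [q] with [q(t) = 0], and [iota] is
    injective. *)
Lemma var_transcendental : ~ integralOver cst t.
Proof.
case=> q monq; rewrite map_poly_comp /root horner_map -(rmorph0 iota).
rewrite (inj_eq (@poly_to_ext_inj _ _)) -[_.['X]]/(q \Po 'X) comp_polyXr.
by rewrite (negPf (monic_neq0 monq)).
Qed.

Lemma cst_poly_integral (f : {poly F}) : {in map_poly cst f : seq L, integralRange cst}.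
Proof. by apply/integral_poly => i; rewrite coef_map; apply: integral_id. Qed.

(** A root [x] determines [t = - M(x) / x^m], so [t] would be algebraic over [F] along with [x]. *)
Lemma roots_transcendental x : x \in rs -> ~ integralOver cst x.
Proof.
move=> rx ix; apply: var_transcendental.
have -> : t = - (map_poly cst M).[x] / x ^+ m.
  by rewrite roots_eq // opprK mulfK // expf_neq0 // roots_neq0.
apply: integral_div; last first.
  rewrite -hornerXn -(map_polyXn cst); apply: integral_horner => //.
  exact: cst_poly_integral.
by apply/integral_opp/integral_horner => //; apply: cst_poly_integral.
Qed.

Lemma roots_cst_poly x (f : {poly F}) : x \in rs -> root (map_poly cst f) x -> f = 0.
Proof.
move=> rx fx; apply/eqP; apply: contraT => nzf; case: (roots_transcendental rx).
by apply: integral_root fx _; rewrite ?map_poly_eq0 //; apply: cst_poly_integral.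
Qed.

Lemma roots_neq_cst x c : x \in rs -> x != cst c.
Proof.
move=> rx; apply/negP => /eqP e; apply: (roots_transcendental rx).
by rewrite e; apply: integral_id.
Qed.

(** Writing [M(x) = x^m h(x + 1/x)], the zero of [M] at 1 becomes a zero of [h] at 2. The roots of
    the pencil therefore satisfy [h1(Y) (Y - 2) = - t] with [Y = x + 1/x]. *)
Lemma exists_reciprocal_poly :
  exists h1 : {poly F}, forall (K : fieldType) (f : {rmorphism F -> K}) (x : K),
    x != 0 -> (map_poly f M).[x] =
      x ^+ m * ((map_poly f h1).[x + x^-1] * (x + x^-1 - 2%:R)).
Proof.
have [h hE] := @palindromic_poly F m M (eq_leq szM) palM.
have : root h (1 + 1).
  have := hE F idfun 1 (oner_neq0 _); rewrite !map_poly_id // expr1n mul1r invr1.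
  by rewrite MG !hornerE subrr expr0n mul0r => /esym/eqP.
case/factor_theorem => h1 eh; exists h1 => K f x nzx.
by rewrite hE // eh rmorphM /= map_polyXsubC !hornerE rmorphD rmorph1.
Qed.

Lemma rootsV x : x \in rs -> x^-1 \in rs.
Proof.
move=> rx; have [h1 h1E] := exists_reciprocal_poly; have nzx := roots_neq0 rx.
rewrite -pencil_root /root pencil_horner h1E ?invr_eq0 // invrK [x^-1 + x]addrC.
rewrite -mulrC [t * _]mulrC [_ * x^-1 ^+ m]mulrC -mulrDr mulf_eq0.
apply/orP; right; have := roots_eq rx; rewrite h1E // mulrC [t * _]mulrC -mulNr mulrC.
by rewrite mulNr -mulrN => /(mulfI (expf_neq0 m nzx)) ->; rewrite addNr.
Qed.

(** A self-inverse root would be 1 or -1, a constant. *)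
Lemma rootsV_neq x : x \in rs -> x^-1 != x.
Proof.
move=> rx; apply/negP => /eqP e; have nzx := roots_neq0 rx.
have : (x - 1) * (x + 1) == 0.
  by rewrite -subr_sqr expr1n expr2 -{1}e mulVf // subrr.
rewrite mulf_eq0 subr_eq0 addr_eq0 -(rmorph1 cst) -rmorphN /=.
by rewrite !(negPf (roots_neq_cst _ rx)).
Qed.

(** Eliminating [t] between the pencil and its derivative leaves this polynomial, which vanishes at
    every double root. If it were zero, dividing by ['X - 1] and evaluating at 1 gives
    characteristic 2, then evaluating at 0 gives [m = 0] in [F], so [G] has zero derivative.
    Separability makes [G] constant, hence [m = 1], a contradiction. *)
Lemma pencil_wronskian_neq0 : 'X * M^`() - m%:R *: M != 0.
Proof.
apply/negP => /eqP; rewrite MG expr2 !derivM derivB derivX -polyC1 derivC subr0 !mulr1.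
rewrite mul1r polyC1 => e.
have {}e : 2%:R *: ('X * G) + ('X - 1) * ('X * G^`() - m%:R *: G) = 0.
  have nz : 'X - 1 != 0 :> {poly F} by rewrite -polyC1 polyXsubC_eq0.
  apply: (mulfI nz); rewrite mulr0 -[RHS]e -!mul_polyC; ring.
have /eqP : 2%:R * G.[1] = 0.
  by have := congr1 (horner^~ 1) e; rewrite !hornerE subrr mul0r addr0 /= mulr1.
rewrite mulf_eq0 (negPf G1) orbF => /eqP e2.
move: e; rewrite e2 scale0r add0r => /eqP.
rewrite mulf_eq0 -{1}polyC1 polyXsubC_eq0 /= => /eqP e.
have /eqP : m%:R * G.[0] = 0.
  have := congr1 (horner^~ 0) e; rewrite !hornerE ?mul0r ?sub0r => /eqP.
  by rewrite oppr_eq0 => /eqP.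
have -> : G.[0] = 1.
  by move: M0; rewrite MG !hornerE ?sub0r ?sqrrN ?expr1n ?mul1r.
rewrite mulr1 => /eqP m0; move: e; rewrite m0 scale0r subr0 => /eqP.
rewrite mulf_eq0 polyX_eq0 /= => /eqP G'0.
move: sepG; rewrite unlock G'0 coprimep0 -size_poly_eq1 => /eqP szG.
have nzG : G != 0 by rewrite -size_poly_gt0 szG.
have : size M = 3%N.
  by rewrite MG size_monicM ?monic_exp -?polyC1 ?monicXsubC // size_exp_XsubC szG.
rewrite szM => -[] e; have m1 : m = 1%N.
  by apply/eqP; rewrite -(eqn_pmul2l (isT : 0 < 2)%N) e.
by move/eqP: m0; rewrite m1 oner_eq0.
Qed.

Lemma pencil_separable : separable_poly p.
Proof.
rewrite unlock {1}pencil_prod big_seq.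
apply: (big_ind (fun f => coprimep f _)) => [|f g cf cg|x rx]; first exact: coprime1p.
  by rewrite coprimepMl cf.
rewrite coprimep_sym coprimep_XsubC; apply/negP => p'x.
have /eqP := pencil_wronskian_neq0; apply; apply: (roots_cst_poly rx).
move: p'x; rewrite /root pencilE derivD derivM derivC derivXn mul0r add0r.
rewrite deriv_map !hornerE ?hornerMn ?hornerXn => /eqP e.
rewrite rmorphB rmorphM /= map_polyX map_polyZ rmorph_nat !hornerE roots_eq //.
move/eqP: e; rewrite addr_eq0 => /eqP ->; have := pencil_size_gt0.
by case: (m) => //= k _; rewrite exprS -mulr_natl; apply/eqP; ring.
Qed.

Lemma roots_uniq : uniq rs.
Proof. by rewrite -separable_prod_XsubC -pencil_prod pencil_separable. Qed.

Lemma pencil_polyOver1 : p \is a polyOver 1%VS.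
Proof. by apply/polyOver1P; exists (Mt M m). Qed.

Lemma pencil_galois : galois 1 {:L}.
Proof.
apply/splitting_galoisField; exists p; split.
- exact: pencil_polyOver1.
- exact: pencil_separable.
- by exists rs.
Qed.

(** * Irreducibility of the pencil and transitivity on its roots *)

(** Gauss's lemma through integrality: the coefficients of [f] are integral, as its roots are, and
    lie in the base field. *)
Lemma pencil_factor_lift (f : {poly L}) :
  f \is monic -> f %| p -> f \is a polyOver 1%VS -> exists q, f = map_poly iota q.
Proof.
move=> monf; rewrite pencil_prod => /dvdp_prod_XsubC[b].
rewrite eqp_monic ?monic_prod_XsubC // => /eqP ef f1.
have Bf : f \is a polyOver B.
  rewrite ef big_seq; apply: rpred_prod => x /mem_mask rx.
  by rewrite polyOverXsubC roots_int.
have lift i : exists c, f`_i = iota c.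
  by apply: int_closure_base; [apply: (polyOverP Bf)|apply: (polyOverP f1)].
have [c ec] := choice lift.
exists (\poly_(i < size f) c i); apply/polyP => i.
rewrite coef_map coef_poly; case: ltnP => [_|le] /=; first exact: ec.
by rewrite rmorph0 nth_default.
Qed.

(* [MtXY] has degree 1 in [t], so one factor of any factorization has
   coefficients in [F], contradicting the transcendence of its roots. *)
Lemma roots_transitive x y : x \in rs -> y \in rs -> exists s : gal_of {:L}, s x = y.
Proof.
move=> rx ry.
pose q := minPoly 1 x; pose r := p %/ q.
have monq : q \is monic by exact: monic_minPoly.
have qp : q %| p by rewrite minPoly_dvdp ?pencil_polyOver1 ?pencil_root.
have pE : p = r * q by rewrite divpK.
have monr : r \is monic by have := pencil_monic; rewrite pE monicMr.
have [q' eq'] := pencil_factor_lift monq qp (minPolyOver 1 x).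
have rp : r %| p by rewrite [X in _ %| X]pE dvdp_mulIl.
have r1 : r \is a polyOver 1%AS.
  by apply: divp_polyOver; [apply: pencil_polyOver1 | apply: minPolyOver].
have [r' er'] := pencil_factor_lift monr rp r1.
have eM : r' * q' = MtXY.
  apply: (map_inj_poly (@poly_to_ext_inj F L)); first exact: rmorph0.
  by rewrite rmorphM /= -eq' -er' -pE pencil_lift.
have swapM : swapXY MtXY = 'X * ('X^m)%:P + M%:P.
  rewrite rmorphD rmorphM /= swapXY_map_polyC swapXY_Y addrC.
  by rewrite -(map_polyXn (@polyC F)) swapXY_map_polyC.
have szY : size (swapXY r' * swapXY q') = 2%N.
  rewrite -rmorphM /= eM swapM mulrC size_MXaddC polyC_eq0 -size_poly_eq0 size_polyXn.
  by rewrite /= size_polyC monic_neq0 ?monicXn.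
have nz : swapXY r' * swapXY q' != 0 by rewrite -size_poly_eq0 szY.
have [nzr nzq] : swapXY r' != 0 /\ swapXY q' != 0.
  by apply/andP; rewrite -negb_or -mulf_eq0.
have cst1 (f : {poly {poly F}}) : (size (swapXY f) <= 1)%N -> 
    exists c, map_poly iota f = map_poly cst c.
  move=> /size1_polyC e; exists (swapXY f)`_0.
  have ef : f = ((swapXY f)`_0)^:P by rewrite -swapXY_polyC -e swapXYK.
  by rewrite {1}ef -map_poly_comp.
have [szq|szq] := leqP (size (swapXY q')) 1.
  have [c ec] := cst1 _ szq; have : c = 0.
    by apply: (roots_cst_poly rx); rewrite -ec -eq' root_minPoly.
  by move=> c0; move: monq; rewrite eq' ec c0 rmorph0 monicE lead_coef0 eq_sym oner_eq0.
have szr : (size (swapXY r') <= 1)%N.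
  move: szY; rewrite size_mul //; move: szq.
  case: (size (swapXY q')) => [|[|k]] // _; case: (size (swapXY r')) => [|[|l]] //.
  by rewrite !addnS.
have [c ec] := cst1 _ szr.
(* Here [r] has constant coefficients, so a transcendental [y] cannot be its root and must be a
   conjugate of [x]. *)
have ryq : root q y.
  have := ry; rewrite -pencil_root pE rootM => /orP[|//] ry'.
  have c0 : c = 0 by apply: (roots_cst_poly ry); rewrite -ec -er'.
  by move: monr; rewrite er' ec c0 rmorph0 monicE lead_coef0 eq_sym oner_eq0.
have [s _ sx] := normalField_root_minPoly (sub1v _) (normalFieldf 1) (memvf x) ryq.
by exists s.
Qed.

Lemma gal_roots (s : gal_of {:L}) x : x \in rs -> s x \in rs.
Proof.
rewrite -!pencil_root => rx.
have -> : p = map_poly s p.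
  by rewrite -map_poly_comp; apply: eq_map_poly => k /=; rewrite rmorph_alg.
by rewrite fmorph_root.
Qed.

Lemma gal_roots_eq (s s' : gal_of {:L}) :
  (forall x, x \in rs -> s x = s' x) -> s = s'.
Proof.
move=> e; apply/eqP; rewrite -(can_eq (mulgK s'^-1%g)) mulgV; apply/gal_eqP => x _.
rewrite gal_id; apply/fixedSpaceP.
suff /subvP : (<<1 & rs>> <= fixedSpace (s * s'^-1)%g)%VS.
  by apply; rewrite gen_rs memvf.
apply/Fadjoin_seqP; split=> [|y ry]; first exact: sub1v.
by apply/fixedSpaceP; rewrite galM ?memvf // e // -galM ?memvf // mulgV gal_id.
Qed.

(** * The roots modulo a prime above [t] *)

Section Inertia.

Variable P : zmodClosed L.
Hypotheses (primeP : prime_ideal_of B P) (PX : t \in P).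

Lemma cst_int c : cst c \in B.
Proof. exact: poly_to_ext_int. Qed.

Lemma cst_horner_int (f : {poly F}) x : x \in B -> (map_poly cst f).[x] \in B.
Proof.
move=> Bx; apply: rpred_horner => //.
by apply/polyOverP => i; rewrite coef_map cst_int.
Qed.

(** Taylor expansion with remainder in [B], so that [x - y] can be cancelled in [L] before reducing
    modulo [P]. *)
Lemma horner_taylor2 (f : {poly F}) x y : x \in B -> y \in B ->
  exists2 c, c \in B & (map_poly cst f).[x] - (map_poly cst f).[y] =
    (x - y) * ((map_poly cst f^`()).[y] + (x - y) * c).
Proof.
move=> Bx By; elim/poly_ind: f => [|f c [d Bd e]].
  by exists 0; rewrite ?rpred0 // deriv0 rmorph0 !horner0; ring.
exists ((map_poly cst f^`()).[y] + d * x).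
  by rewrite rpredD ?rpredM ?cst_horner_int.
rewrite derivD derivM derivX derivC mulr1 addr0 !(rmorphD, rmorphM) /=.
rewrite map_polyC map_polyX !hornerE.
have -> : (map_poly cst f).[x] = (map_poly cst f).[y] +
    (x - y) * ((map_poly cst f^`()).[y] + (x - y) * d).
  by rewrite -e addrC subrK.
by ring.
Qed.

Lemma horner_taylor1 (f : {poly F}) x y : x \in B -> y \in B ->
  exists2 c, c \in B & (map_poly cst f).[x] - (map_poly cst f).[y] = (x - y) * c.
Proof.
move=> Bx By; have [c Bc ->] := horner_taylor2 f Bx By.
exists ((map_poly cst f^`()).[y] + (x - y) * c) => //.
by rewrite rpredD ?rpredM ?rpredB ?cst_horner_int.
Qed.

Lemma prime_prod (r : seq L) (f : L -> L) : (forall x, x \in r -> f x \in B) ->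
  \prod_(x <- r) f x \in P -> exists2 x, x \in r & f x \in P.
Proof.
elim: r => [|x r IH] Br; first by rewrite big_nil; case: primeP => _ _ /negPf ->.
have Br' y : y \in r -> f y \in B by move=> ry; rewrite Br // inE ry orbT.
rewrite big_cons => /(prime_mulI primeP) /orP[||Px|/(IH Br')[y ry Py]].
- by rewrite Br ?mem_head.
- by rewrite big_seq rpred_prod.
- by exists x; rewrite ?mem_head.
- by exists y; rewrite // inE ry orbT.
Qed.

(** The product of all [1 - x] is the value of the pencil at 1, which is [t] because [M] vanishes
    there. *)
Lemma exists_root_over1 : exists2 a, a \in rs & a - 1 \in P.
Proof.
have [x rx||a ra Pa] := @prime_prod rs (fun x => 1 - x).
- by rewrite rpredB ?rpred1 ?roots_int.
- have -> : \prod_(x <- rs) (1 - x) = p.[1].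
    by rewrite pencil_prod horner_prod; apply: eq_bigr => x _; rewrite !hornerE.
  rewrite pencil_horner -(rmorph1 cst) horner_map MG !hornerE subrr expr0n mul0r.
  by rewrite rmorph0 add0r rmorph1 expr1n mulr1.
by exists a; rewrite // -rpredN opprB.
Qed.

Lemma roots_factor x : x \in rs ->
  (x - 1) ^+ 2 * (map_poly cst G).[x] = - (t * x ^+ m).
Proof.
move=> rx; rewrite -roots_eq // MG rmorphM rmorphXn rmorphB rmorph1 /= map_polyX.
by rewrite !hornerE.
Qed.

Lemma roots_horner_G1 a : a \in rs -> a - 1 \in P -> (map_poly cst G).[a] \notin P.
Proof.
move=> ra Pa; apply: contra G1 => PG; apply/eqP/(prime_const primeP).
have [c Bc] := horner_taylor1 G (roots_int ra) (rpred1 B).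
rewrite -{1}(rmorph1 cst) horner_map => e.
have -> : iota G.[1]%:P = (map_poly cst G).[a] - (a - 1) * c.
  by rewrite -e opprB addrC subrK.
by rewrite rpredB // (prime_mulr primeP).
Qed.

Lemma prime_rootsV a : a \in rs -> a - 1 \in P -> a^-1 - 1 \in P.
Proof.
move=> ra Pa; have nza := roots_neq0 ra.
have -> : a^-1 - 1 = - (a^-1 * (a - 1)) by field.
by rewrite rpredN (prime_mull primeP) // roots_int // rootsV.
Qed.

(** In terms of [Y = x + 1/x], the value 2 is a simple zero of [h1(Y) (Y - 2)] modulo [P], so [a]
    and [b] share the same [Y]. *)
Lemma roots_over1 a b : a \in rs -> b \in rs -> a - 1 \in P -> b - 1 \in P ->
  b = a \/ b = a^-1.
Proof.
move=> ra rb Pa Pb; have [h1 h1E] := exists_reciprocal_poly.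
have [nza nzb] := (roots_neq0 ra, roots_neq0 rb).
have hE x : x \in rs -> (map_poly cst h1).[x + x^-1] * (x + x^-1 - 2%:R) = - t.
  move=> rx; have nzx := expf_neq0 m (roots_neq0 rx); apply: (mulfI nzx).
  by rewrite -h1E ?roots_neq0 // roots_eq //; ring.
have BY x : x \in rs -> x + x^-1 \in B.
  by move=> rx; rewrite rpredD ?roots_int ?rootsV.
set ya := a + a^-1 in hE *; set yb := b + b^-1.
have ha : (map_poly cst h1).[ya] \notin P.
  apply: contra (roots_horner_G1 ra Pa) => Ph.
  have a1 : a - 1 != 0 by rewrite subr_eq0 -(rmorph1 cst) roots_neq_cst.
  (* Since [Y - 2 = (a - 1)^2 / a], the two factorizations of [M(a)] can be compared after
     cancelling [(a - 1)^2]. *)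
  have -> : (map_poly cst G).[a] = a ^+ m.-1 * (map_poly cst h1).[ya].
    apply: (mulfI (expf_neq0 2 a1)); rewrite roots_factor // -mulNr -(hE a ra) -/ya.
    have -> : ya - 2%:R = (a - 1) ^+ 2 / a by rewrite /ya; field.
    have := pencil_size_gt0; case: (m) => //= k _.
    by rewrite [a ^+ k.+1]exprS; field; exact: nza.
  by rewrite (prime_mull primeP) // rpredX // roots_int.
have [c Bc ec] := horner_taylor1 h1 (BY a ra) (BY b rb).
have PV : yb - 2%:R \in P.
  have -> : yb - 2%:R = (b - 1) * ((b - 1) * b^-1) by rewrite /yb; field.
  by rewrite (prime_mulr primeP) // rpredM ?rpredB ?rpred1 ?roots_int ?rootsV.
have [eY|neY] := eqVneq ya yb.
  have /eqP : (a - b) * (1 - (a * b)^-1) = 0.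
    transitivity (ya - yb); last by rewrite eY subrr.
    by rewrite /ya /yb; field; rewrite nza nzb.
  rewrite mulf_eq0 !subr_eq0 => /orP[/eqP ->|]; first by left.
  rewrite eq_sym invr_eq1 => /eqP ab; right.
  by apply: (mulfI nza); rewrite ab divff.
(* Subtracting the equations for [ya] and [yb] and cancelling [ya - yb] expresses [h1(ya)] as a
   multiple of [yb - 2], which is in [P]. *)
case/negP: ha; have : (map_poly cst h1).[ya] + (yb - 2%:R) * c = 0.
  have nzY : ya - yb != 0 by rewrite subr_eq0.
  apply: (mulfI nzY); rewrite mulr0.
  have eh : (map_poly cst h1).[yb] = (map_poly cst h1).[ya] - (ya - yb) * c.
    by rewrite -ec opprB addrC subrK.
  transitivity ((map_poly cst h1).[ya] * (ya - 2%:R) -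
                (map_poly cst h1).[yb] * (yb - 2%:R)).
    by rewrite eh; ring.
  by rewrite (hE a ra) (hE b rb) subrr.
move/eqP; rewrite addr_eq0 => /eqP ->.
by rewrite rpredN (prime_mulr primeP).
Qed.

(** Distinct congruent roots would make [b] a double zero of [M] modulo [P]; away from 1 it would be
    a double zero of [G], against a Bezout relation between [G] and its derivative. *)
Lemma roots_separated b c :
  b \in rs -> c \in rs -> b - 1 \notin P -> c - b \in P -> c = b.
Proof.
move=> rb rc Pb Pcb; have [Bb Bc] := (roots_int rb, roots_int rc).
have [//|ncb] := eqVneq c b.
have nzcb : c - b != 0 by rewrite subr_eq0.
have [d Bd ed] := horner_taylor2 M Bc Bb.
have [e Be ee] := horner_taylor1 'X^m Bc Bb.
rewrite !map_polyXn !hornerXn in ee.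
have Bb1 : b - 1 \in B by rewrite rpredB ?rpred1.
have Pmul := prime_mull primeP; have Pmulr := prime_mulr primeP.
have PI := prime_mulI primeP.
have PM' : (map_poly cst M^`()).[b] \in P.
  have : (c - b) * ((map_poly cst M^`()).[b] + (c - b) * d + t * e) = 0.
    by rewrite mulrDr -ed mulrCA -ee !roots_eq //; ring.
  move/eqP; rewrite mulf_eq0 (negPf nzcb) /= -addrA addr_eq0 => /eqP ->.
  by rewrite rpredN rpredD // Pmulr.
have PG : (map_poly cst G).[b] \in P.
  have : (b - 1) ^+ 2 * (map_poly cst G).[b] \in P.
    by rewrite roots_factor // rpredN Pmulr // rpredX.
  case/PI/orP; rewrite ?rpredX ?cst_horner_int // expr2.
  by case/PI/orP; rewrite // (negPf Pb).
have PG' : (map_poly cst G^`()).[b] \in P.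
  have : (b - 1) ^+ 2 * (map_poly cst G^`()).[b] \in P.
    have -> : (b - 1) ^+ 2 * (map_poly cst G^`()).[b] =
        (map_poly cst M^`()).[b] - 2%:R * (b - 1) * (map_poly cst G).[b].
      rewrite MG expr2 !derivM derivB derivX -polyC1 derivC subr0 polyC1.
      rewrite !(rmorphD, rmorphM, rmorphN, rmorph1) /= map_polyX !hornerE /=; ring.
    by rewrite rpredB // Pmul // rpredM // rpred_nat.
  case/PI/orP; rewrite ?rpredX ?cst_horner_int // expr2.
  by case/PI/orP; rewrite // (negPf Pb).
have : 1 \in P; last by case: primeP => _ _ /negPf ->.
move: sepG; rewrite unlock => /Bezout_eq1_coprimepP[[u v] /= /(congr1 (map_poly cst))].
rewrite !(rmorphD, rmorphM, rmorph1) /= => /(congr1 (horner^~ b)); rewrite !hornerE => <-.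
by rewrite rpredD // Pmul // cst_horner_int.
Qed.

Lemma exists_root_swap_over1 a : a \in rs -> a - 1 \in P ->
  exists s : gal_of {:L}, [/\ s a = a^-1, s a^-1 = a &
    forall b, b \in rs -> b != a -> b != a^-1 -> s b = b].
Proof.
move=> ra Pa; have nza := roots_neq0 ra.
have a1 : a - 1 != 0 by rewrite subr_eq0 -(rmorph1 cst) roots_neq_cst.
have Broots x : x \in rs -> x - 1 \in B by move=> rx; rewrite rpredB ?rpred1 ?roots_int.
have PaV := prime_rootsV ra Pa.
pose r := [seq c <- rs | (c != a) && (c != a^-1)].
have rP c : c \in r -> [/\ c \in rs, c != a & c != a^-1].
  by rewrite mem_filter -andbA => /and3P[].
(* This factor puts all conjugates of [(a - 1) * e] in [P]: either [s] sends [a] to [a] or its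
   inverse, or [a = s c] with [c] in [r] and [a - 1] divides [s e]. *)
pose e := \prod_(c <- r) (c - 1).
have Be : e \in B by rewrite /e big_seq rpred_prod // => c /rP[rc _ _]; rewrite Broots.
have Pe : e \notin P.
  apply/negP => /prime_prod[c /rP[rc _ _]|c /rP[rc ca caV] Pc]; first exact: Broots.
  by have [/eqP|/eqP] := roots_over1 ra rc Pa Pc; apply/negP.
pose w := - (map_poly cst G).[a] * a^-1 ^+ m.
have Bw : w \in B by rewrite rpredM ?rpredN ?rpredX ?cst_horner_int ?roots_int ?rootsV.
have tE : t = (a - 1) ^+ 2 * w.
  apply: (mulIf (expf_neq0 m nza)); apply: oppr_inj; rewrite -(roots_factor ra) /w.
  by rewrite exprVn; field; rewrite expf_neq0.
have [|||s s1 sP] := exists_inertia primeP PX (b := (a - 1) * e) pencil_galois.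
- by rewrite rpredM ?Broots.
- move=> s; have Bs x : x \in rs -> s (x - 1) \in B.
    by move=> rx; rewrite gal_int // Broots.
  rewrite rmorphM /=.
  have [saV|saV] := boolP ((s a == a) || (s a == a^-1)).
    apply: (prime_mulr primeP); first exact: gal_int.
    by rewrite rmorphB rmorph1 /=; case/orP: saV => /eqP ->.
  apply: (prime_mull primeP); first exact: Bs.
  pose c := s^-1%g a.
  have sc : s c = a by rewrite /c -galM ?memvf // mulVg gal_id.
  have rc : c \in r.
    rewrite mem_filter gal_roots // andbT -negb_or; apply: contra saV.
    case/orP => /eqP e'; move: sc; rewrite e' => e''; first by rewrite e'' eqxx.
    by apply/orP; right; rewrite -[s a]invrK -gal_invr e''.
  rewrite /e (big_rem c) //= rmorphM rmorphB rmorph1 /= sc.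
  apply: (prime_mulr primeP) => //.
  apply: gal_int; rewrite big_seq rpred_prod // => c' /mem_rem /rP[rc' _ _].
  exact: Broots.
(* As [t] contains [(a - 1)^2], cancelling one [a - 1] would put [d * e] in [P]. *)
- move=> d c Bd Pd Bc; apply/negP => /eqP eqd.
  have : d * e = (a - 1) * (w * c) by apply: (mulfI a1); rewrite mulrCA eqd tE; ring.
  move=> ede; have /negP := prime_mulN primeP Bd Be Pd Pe; apply.
  by rewrite ede (prime_mulr primeP) // rpredM.
have fixs b : b \in rs -> b != a -> b != a^-1 -> s b = b.
  move=> rb ba baV; apply: roots_separated => //; first exact: gal_roots.
    by apply/negP => Pb; have [/eqP|/eqP] := roots_over1 ra rb Pa Pb; apply/negP.
  by rewrite sP // roots_int.
have Psa : s a - 1 \in P by rewrite -[s a](subrK a) -addrA rpredD // sP // roots_int.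
(* If [s] fixed [a] it would fix every root and be trivial. *)
have sa : s a = a^-1.
  have [sa|//] := roots_over1 ra (gal_roots s ra) Pa Psa.
  case/eqP: s1; apply: gal_roots_eq => x rx; rewrite gal_id.
  have [->//|xa] := eqVneq x a.
  have [->|xaV] := eqVneq x a^-1; first by rewrite gal_invr sa.
  exact: fixs.
by exists s; rewrite gal_invr sa invrK.
Qed.

End Inertia.

Lemma exists_root_swap a : a \in rs ->
  exists s : gal_of {:L}, [/\ s a = a^-1, s a^-1 = a &
    forall b, b \in rs -> b != a -> b != a^-1 -> s b = b].
Proof.
move=> ra.
have [P [primeP PX]] :=
  exists_prime_ideal (poly_to_ext_int L 'X) (@poly_to_extX_nunit F L).
have [a0 ra0 Pa0] := exists_root_over1 primeP PX.
have [s [sa _ sfix]] := exists_root_swap_over1 primeP PX ra0 Pa0.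
have [u ua] := roots_transitive ra0 ra.
have uK x : u (u^-1%g x) = x by rewrite -galM ?memvf // mulVg gal_id.
have uVK x : u^-1%g (u x) = x by rewrite -galM ?memvf // mulgV gal_id.
(* Products of automorphisms act from left to right: [u^-1] carries [a] to [a0], [s] inverts it, and
   [u] returns. *)
have va : (u^-1 * s * u)%g a = a^-1.
  by rewrite !galM ?memvf // -ua uVK sa gal_invr.
exists (u^-1 * s * u)%g; split=> //; first by rewrite gal_invr va invrK.
move=> b rb ba baV; rewrite !galM ?memvf // sfix ?uK ?gal_roots //.
  by apply: contra ba => /eqP e; rewrite -(uK b) e ua.
by apply: contra baV => /eqP e; rewrite -(uK b) e gal_invr ua.
Qed.

End Pencil.

(** * The group generated by the swaps *)

(** [q] holds one representative of each orbit; the induction removes the head of the list together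
    with its image. *)
Lemma involution_transversal (T : eqType) (f : T -> T) (r : seq T) :
    uniq r -> {in r, forall x, f x \in r} -> {in r, forall x, f (f x) = x} ->
    {in r, forall x, f x != x} ->
  exists q, perm_eq r (q ++ map f q).
Proof.
have [n] := ubnP (size r); elim: n r => // n IH [|x r] /= szr; first by exists [::].
case/andP=> xr ur fr ff fn.
have fxr : f x \in r.
  by have := fr x (mem_head _ _); rewrite inE (negPf (fn x (mem_head _ _))).
have sub y : y \in rem (f x) r -> (y \in x :: r) && (y != f x).
  by rewrite mem_rem_uniq // !inE => /andP[-> ->]; rewrite orbT.
have [||y yr|y /sub/andP[/ff]|y /sub/andP[/fn]|q qE] // := IH (rem (f x) r).
- by rewrite size_rem //; move: szr; case: (size r) => //= k; lia.
- exact: rem_uniq.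
- have /andP[yxr yfx] := sub y yr; rewrite mem_rem_uniq // inE.
  have nyx : y != x by apply: contraNneq xr => <-; apply: mem_rem yr.
  apply/andP; split.
    by apply: contra nyx => /eqP e; rewrite -(ff y yxr) e ff ?mem_head.
  have := fr y yxr; rewrite inE => /orP[/eqP e|//].
  by case/negP: yfx; rewrite -e ff.
exists (x :: q) => /=; rewrite perm_cons (perm_trans (perm_to_rem fxr)) //.
by rewrite perm_sym -cat1s perm_catCA perm_cons perm_sym.
Qed.

Section PairKernel.

Variables (K : fieldType) (L : splittingFieldType K) (rs : seq L) (m : nat).
Hypotheses (rs_uniq : uniq rs) (size_rs : size rs = (2 * m)%N).
Hypothesis rsV : {in rs, forall x, x^-1 \in rs}.
Hypothesis rsV_neq : {in rs, forall x, x^-1 != x}.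
Hypothesis gal_rs : forall (s : gal_of {:L}) x, x \in rs -> s x \in rs.
Hypothesis gal_rs_eq : forall s s' : gal_of {:L},
  (forall x, x \in rs -> s x = s' x) -> s = s'.
Hypothesis swap_rs : forall a, a \in rs ->
  exists s : gal_of {:L}, [/\ s a = a^-1, s a^-1 = a &
    forall b, b \in rs -> b != a -> b != a^-1 -> s b = b].

(** The kernel of the action on the pairs [{b, b^-1}]. *)
Let kernel := [set s : gal_of {:L} | all (fun b => (s b == b) || (s b == b^-1)) rs].

Let kernelP (s : gal_of {:L}) :
  reflect (forall b, b \in rs -> s b = b \/ s b = b^-1) (s \in kernel).
Proof.
rewrite inE; apply: (iffP allP) => h b /h; first by case/orP => /eqP; auto.
by case=> ->; rewrite eqxx ?orbT.
Qed.

Let kernel_group_set : group_set kernel.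
Proof.
apply/group_setP; split=> [|s u /kernelP Ns /kernelP Nu].
  by apply/kernelP => b _; rewrite gal_id; left.
apply/kernelP => b rb; rewrite galM ?memvf //.
by case: (Ns b rb) => ->; case: (Nu b rb) => e; rewrite ?gal_invr e ?invrK; auto.
Qed.

Let kernel_normal (H : {group gal_of {:L}}) : kernel \subset H -> (kernel <| H)%g.
Proof.
move=> sNH; rewrite /normal sNH /=; apply/subsetP => u _; rewrite inE.
apply/subsetP => _ /imsetP[s /kernelP Ns ->]; apply/kernelP => b rb.
have uK : u (u^-1%g b) = b by rewrite -galM ?memvf // mulVg gal_id.
rewrite !galM ?memvf //.
by case: (Ns (u^-1%g b) (gal_rs _ rb)) => ->; rewrite ?gal_invr uK; auto.
Qed.

(** On each root an element of [kernel] is the identity or inversion, and these commute and square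
    to the identity. *)
Let kernel_abelem : (2.-abelem kernel)%g.
Proof.
apply/(@abelemP _ 2 (Group kernel_group_set)) => //; split=> /=.
  apply/centsP => s /kernelP Ns u /kernelP Nu; apply: gal_rs_eq => b rb.
  rewrite !galM ?memvf //.
  by case: (Ns b rb) => es; case: (Nu b rb) => eu; rewrite ?es ?eu ?gal_invr ?es ?eu.
move=> s /kernelP Ns; apply: gal_rs_eq => b rb; rewrite expgS expg1 galM ?memvf // gal_id.
by case: (Ns b rb) => es; rewrite ?es ?gal_invr ?es ?invrK.
Qed.

Let card_kernel : #|kernel| = (2 ^ m)%N.
Proof.
have [x rx|q rsq] := involution_transversal rs_uniq rsV _ rsV_neq; first exact: invrK.
have szq : size q = m.
  by have := perm_size rsq; rewrite size_rs size_cat size_map; lia.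
have qrs x : x \in q -> x \in rs by move=> qx; rewrite (perm_mem rsq) mem_cat qx.
have rsE x : x \in rs -> exists i : 'I_m, x = q`_i \/ x = (q`_i)^-1.
  rewrite (perm_mem rsq) mem_cat => /orP[qx|/mapP[y qx ->]].
    have lti : (index x q < m)%N by rewrite -szq index_mem.
    by exists (Ordinal lti); left; rewrite nth_index.
  have lti : (index y q < m)%N by rewrite -szq index_mem.
  by exists (Ordinal lti); right; rewrite nth_index.
have qi (i : 'I_m) : q`_i \in q by rewrite mem_nth // szq.
have := rs_uniq; rewrite (perm_uniq rsq) cat_uniq => /and3P[uq /hasPn qV _].
have qV_neq (i j : 'I_m) : q`_j != (q`_i)^-1.
  by apply: contraTneq (qi j) => ->; apply: qV; rewrite map_f.
have q_neq (i j : 'I_m) : j != i -> q`_j != q`_i.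
  by move=> nij; rewrite nth_uniq ?szq.
(* Recording which pairs are inverted identifies [kernel] with the subsets of ['I_m]. *)
pose moved (s : gal_of {:L}) := [set i : 'I_m | s q`_i != q`_i].
have movedP s (i : 'I_m) :
    s \in kernel -> s q`_i = if i \in moved s then (q`_i)^-1 else q`_i.
  move=> /kernelP Ns; rewrite inE.
  by case: (Ns q`_i (qrs _ (qi i))) => ->; rewrite ?eqxx ?rsV_neq ?qrs.
rewrite -[m in RHS]card_ord -cardsT -card_powerset.
have inj : {in kernel &, injective moved}.
  move=> s u Ns Nu e; apply: gal_rs_eq => x /rsE[i [] ->]; rewrite ?gal_invr.
    by rewrite !movedP // e.
  by rewrite !movedP // e.
rewrite -(card_in_imset inj); congr #|pred_of_set _|; apply/setP => A.
rewrite powersetE subsetT; apply/imsetP.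
(* Every subset is attained by multiplying swaps, one for each of its indices. *)
have [n] := ubnP #|A|; elim: n A => // n IH A ltA.
have [->|/set0Pn[i Ai]] := eqVneq A set0.
  exists 1%g; first exact: (group1 (Group kernel_group_set)).
  by apply/setP => i; rewrite !inE gal_id eqxx.
have [|s Ns sA] := IH (A :\ i); first by move: ltA; rewrite (cardsD1 i A) Ai; lia.
have [u [ua uaV ufix]] := swap_rs (qrs _ (qi i)).
have Nu : u \in kernel.
  apply/kernelP => b rb; have [->|ba] := eqVneq b q`_i; first by right.
  have [->|baV] := eqVneq b (q`_i)^-1; first by right; rewrite invrK.
  by left; apply: ufix.
exists (s * u)%g; first exact: (groupM (G := Group kernel_group_set)).
apply/setP => j; rewrite inE galM ?memvf // movedP // -sA in_setD1.
have [->|nji] := eqVneq j i; first by rewrite /= ua rsV_neq ?qrs.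
have uj : u q`_j = q`_j by rewrite ufix ?qrs ?q_neq.
by case: (j \in A); rewrite /= ?gal_invr uj ?eqxx ?rsV_neq ?qrs.
Qed.

Lemma exists_pair_kernel (H : {group gal_of {:L}}) : (forall s, s \in H) ->
  exists N : {group gal_of {:L}},
    [/\ forall s, s \in N <-> (forall b, b \in rs -> s b = b \/ s b = b^-1),
        (N <| H)%g, (2.-abelem N)%g & #|N| = (2 ^ m)%N].
Proof.
move=> HT; exists (Group kernel_group_set); split=> //.
- by move=> s; split=> /kernelP.
- by apply: kernel_normal; apply/subsetP => s _.
Qed.

End PairKernel.

(** * From the hypotheses of the theorem to the pencil *)

Lemma self_reciprocal_coef (F : fieldType) (M : {poly F}) (d : nat) :
    size M = d.+1 -> M.[0] = 1 -> self_reciprocal M ->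
  forall i, (i <= d)%N -> M`_i = M`_(d - i).
Proof.
move=> szM M0 [_]; rewrite M0 invr1 scale1r => e i lei.
by rewrite {1}e coef_poly szM ltnS lei subn1.
Qed.

Lemma separable_prod_irreducible (F : finFieldType) (n : nat) (g : 'I_n -> {poly F}) :
    (forall i, g i \is monic) -> (forall i, irreducible_poly (g i)) ->
    (forall i j, g i = g j -> i = j) -> separable_poly (\prod_(i < n) g i).
Proof.
move=> mong irrg injg.
have cop i j : i != j -> coprimep (g i) (g j).
  move=> nij; rewrite irreducible_poly_coprime //; apply/negP => dvd.
  case/eqP: nij; apply: injg; apply/eqP; rewrite -eqp_monic //.
  apply: (irrg j).2 => //; have [sz _] := irrg i.
  by rewrite neq_ltn sz orbT.
have : uniq (index_enum 'I_n) by exact: index_enum_uniq.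
elim: (index_enum _) => [|i r IH] /=; first by rewrite big_nil unlock coprime1p.
case/andP=> ir ur; rewrite big_cons separable_mul IH //.
rewrite irreducible_separable_finField //=.
rewrite big_seq; apply: (big_ind (fun f => coprimep (g i) f)) => [|f f' cf cf'|j jr].
- exact: coprimep1.
- by rewrite coprimepMr cf.
- by apply: cop; apply: contraNneq ir => ->.
Qed.

Lemma monic_irreducible_root (F : fieldType) (g : {poly F}) c :
  g \is monic -> irreducible_poly g -> root g c -> g = 'X - c%:P.
Proof.
move=> mong irrg; rewrite root_factor_theorem => dvd.
apply/esym/eqP; rewrite -eqp_monic ?monicXsubC //; apply: irrg.2 => //.
by rewrite size_XsubC.
Qed.

(** The conditions on the factors [g i] enter here as a separable [G] with [G.[1] != 0]. *)
Lemma pencil_swaps (F : fieldType) (m : nat) (M G : {poly F})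
    (L : splittingFieldType {fraction {poly F}}) :
  M \is monic -> size M = (2 * m).+1 -> M.[0] = 1 -> self_reciprocal M ->
  M = ('X - 1) ^+ 2 * G -> G.[1] != 0 -> separable_poly G ->
  splittingFieldFor 1%AS (map_poly (in_alg L) (Mt M m)) fullv ->
  let H := 'Gal({:L} / 1%AS)%G in
  let isroot := root (map_poly (in_alg L) (Mt M m)) in
  (forall a, isroot a ->
     exists2 s, s \in H &
       [/\ s a = a^-1, s a^-1 = a &
           forall b, isroot b -> b != a -> b != a^-1 -> s b = b]) /\
  (exists N : {group gal_of {:L}},
     [/\ forall s, s \in N <->
           (s \in H /\ forall b, isroot b -> s b = b \/ s b = b^-1),
         (N <| H)%g, (2.-abelem N)%g & #|N| = (2 ^ m)%N]).
Proof.
move=> monM szM M0 recM MG G1 sepG [rs p_rs gen_rs] H isroot.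
have palM := self_reciprocal_coef szM M0 recM.
have isrootE x : isroot x = (x \in rs) by exact: (pencil_root monM szM MG p_rs).
have swap := exists_root_swap monM szM MG M0 G1 sepG palM p_rs gen_rs.
split=> [a|].
  rewrite isrootE => /swap[s [sa saV sfix]]; exists s; first exact: gal_mem.
  by split=> // b; rewrite isrootE; apply: sfix.
have [N [NP nN aN cN]] := exists_pair_kernel
  (roots_uniq monM szM MG M0 G1 sepG p_rs) (size_roots monM szM MG p_rs)
  (rootsV monM szM MG M0 palM p_rs) (rootsV_neq monM szM MG M0 p_rs)
  (gal_roots monM szM MG p_rs) (gal_roots_eq gen_rs) swap
  (@gal_mem F L : forall s, s \in H).
exists N; split=> // s; split=> [/NP Ns|[_ Ns]].
  by split=> [|b]; [exact: gal_mem | rewrite isrootE; apply: Ns].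
by apply/NP => b rb; apply: Ns; rewrite isrootE.
Qed.

Theorem theorem5p2 (F : finFieldType) (m n : nat) (M : {poly F})
    (g : 'I_n -> {poly F})
    (L : splittingFieldType {fraction {poly F}}) :
  M \is monic -> size M = (2 * m).+1 -> M.[0] = 1 -> self_reciprocal M ->
  M = ('X - 1) ^+ 2 * \prod_(i < n) g i ->
  (forall i, g i \is monic) -> (forall i, irreducible_poly (g i)) ->
  (forall i j, g i = g j -> i = j) ->
  (forall i, g i != 'X - 1 /\ g i != 'X + 1) ->
  splittingFieldFor 1%AS (map_poly (in_alg L) (Mt M m)) fullv ->
  let H := 'Gal({:L} / 1%AS)%G in
  let isroot := root (map_poly (in_alg L) (Mt M m)) in
  (forall a, isroot a ->
     exists2 s, s \in H &
       [/\ s a = a^-1, s a^-1 = a &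
           forall b, isroot b -> b != a -> b != a^-1 -> s b = b]) /\
  (exists N : {group gal_of {:L}},
     [/\ forall s, s \in N <->
           (s \in H /\ forall b, isroot b -> s b = b \/ s b = b^-1),
         (N <| H)%g, (2.-abelem N)%g & #|N| = (2 ^ m)%N]).
Proof.
move=> monM szM M0 recM MG mong irrg injg gN1 splitL.
have sepG := separable_prod_irreducible mong irrg injg.
(* An irreducible monic factor vanishing at 1 would be ['X - 1], which is excluded. *)
have G1 : (\prod_(i < n) g i).[1] != 0.
  rewrite horner_prod; apply/prodf_neq0 => i _; apply/negP => gi1.
  by have [/eqP[]] := gN1 i; apply: monic_irreducible_root gi1.
exact: pencil_swaps monM szM M0 recM MG G1 sepG splitL.
Qed.
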